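(* Let $L$ be a linear subspace of $\mathbb{R}^{\mathbb{N}}$ which is a Banach space and in which the unit vectors $(e_n)$ form a Schauder basis. Then the following are equivalent: (1) $(e_n)$ is a boundedly complete basis of $L$; (2) $L$ is $F_\sigma$ in $\mathbb{R}^{\mathbb{N}}$; (3) $\mathbb{R}^{\mathbb{N}}/L\le_B\mathbb{R}^{\mathbb{N}}/\ell_\infty$.
   Context: Banach spaces are real and $\mathbb{N}=\{0,1,2,\dots\}$. $\mathbb{R}^{\mathbb{N}}$ carries the product topology. $e_n\in\mathbb{R}^{\mathbb{N}}$ is the sequence with $1$ in position $n$ and $0$ elsewhere. That $(e_n)$ forms a Schauder basis of $L$ means that $e_n\in L$ for all $n$, that every $a\in L$ has a unique expansion as a norm-convergent series $\sum_n c_n e_n$ in the norm of $L$, and that the coefficients are the coordinates, $c_n=a(n)$. A basis $(x_n)$ of a Banach space $X$ is boundedly complete if for every $a\in\mathbb{R}^{\mathbb{N}}$ with $\sup_n\|\sum_{i\le n}a(i)x_i\|<\infty$ the series $\sum_n a(n)x_n$ converges. For a linear subspace $M\subseteq\mathbb{R}^{\mathbb{N}}$, $\mathbb{R}^{\mathbb{N}}/M$ denotes the equivalence relation on $\mathbb{R}^{\mathbb{N}}$ in which $a,b$ are equivalent iff $a-b\in M$. $\ell_\infty$ is the space of bounded real sequences. For equivalence relations $E,F$ on Polish spaces $X,Y$, $E\le_B F$ ($E$ is Borel reducible to $F$) means there is a Borel function $\theta:X\to Y$ with $(x,y)\in E\iff(\theta(x),\theta(y))\in F$ for all $x,y\in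 X$. *)

(* Defs.v *)
From HB Require Import structures.
From mathcomp Require Export all_boot all_order all_algebra.
From mathcomp Require Export all_classical all_reals all_analysis borel_hierarchy.

Set Implicit Arguments.
Unset Strict Implicit.
Unset Printing Implicit Defensive.

Import Order.TTheory GRing.Theory Num.Theory.
Import numFieldNormedType.Exports.

Local Open Scope classical_set_scope.
Local Open Scope ring_scope.

Definition unit_vector (R : realType) (n : nat) : nat -> R :=
  fun k => (k == n)%:R.

Definition expansion (R : realType) (X : normedModType R) (x : nat -> X)
    (c : nat -> R) (v : X) : Prop :=
  series (fun n => c n *: x n) @ \oo --> v.

Definition schauder_basis (R : realType) (X : normedModType R)
    (x : nat -> X) : Prop :=
  forall v : X, exists! c : nat -> R, expansion x c v.

Definition boundedly_complete_basis (R : realType) (X : normedModType R)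
    (x : nat -> X) : Prop :=
  schauder_basis x /\
  forall a : nat -> R,
    (exists M : R, forall n : nat, `|\sum_(i < n.+1) a i *: x i| <= M) ->
    cvgn (series (fun n => a n *: x n)).

(* [X] is a linear subspace of R^nat seen through its inclusion map [j], and
   [e n] is the n-th unit vector seen as an element of that subspace. *)
Definition unit_vector_basis (R : realType) (X : normedModType R)
    (j : X -> nat -> R) (e : nat -> X) : Prop :=
  [/\ forall n, j (e n) = unit_vector R n,
      schauder_basis e &
      forall (v : X) (c : nat -> R), expansion e c v -> c = j v].

Definition ell_infty (R : realType) : set {ptws nat -> R} :=
  [set a | exists M : R, forall n : nat, `|a n| <= M].

Definition coset_rel (R : realType) (M : set {ptws nat -> R})
    (a b : {ptws nat -> R}) : Prop := M (fun n => a n - b n).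

Definition borel_set (X : topologicalType) : set (set X) := <<s @open X >>.

Definition borel_function (X Y : topologicalType) (f : X -> Y) : Prop :=
  forall B : set Y, borel_set B -> borel_set (f @^-1` B).

Definition borel_reducible (X Y : topologicalType)
    (E : X -> X -> Prop) (F : Y -> Y -> Prop) : Prop :=
  exists theta : X -> Y, borel_function theta /\
    forall x y : X, E x y <-> F (theta x) (theta y).

(* Main.v *)
Require Import Defs.
From mathcomp Require Import ring.

Set Implicit Arguments.
Unset Strict Implicit.
Unset Printing Implicit Defensive.

Import Order.TTheory GRing.Theory Num.Theory.
Import numFieldNormedType.Exports.

Local Open Scope classical_set_scope.
Local Open Scope ring_scope.

(** Write [S_n a] for the partial sum of [a i *: e i] over [i < n].  Since the
    coordinates are the coefficients, [L] is the set of all [a] for which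
    [S_n a] converges, and bounded completeness says that [L] is the set of
    all [a] for which [S_n a] is bounded.

    From bounded completeness the other two properties are read off.  Each
    [S_n] is continuous on R^nat, so the sets [{a | forall n, |S_n a| <= m}]
    are closed, and they exhaust [L].  Moreover [a - b] is in [L] iff the
    distances between [S_n a] and [S_n b] are bounded.  Recording the distances
    from [S_n a] to countably many points, the rational combinations of the
    [e i], maps [a] continuously to a sequence of reals; as these points come
    within 1 of every [S_n b], the sequences attached to [a] and [b] differ by
    a bounded amount iff [S_n a - S_n b] is bounded.

    For the converses let [b] have bounded partial sums; the claim is [L b].
    By Abel summation ([abel_cvg]) the sequence [t * b] is in [L] for every
    [t] that decreases to 0.  Such [t] are produced from points [y] of nat^nat:
    [weight y] is halved at a sequence of places, the gaps between them being
    given by [y].  If the coordinate [y k] is sent to infinity, the weights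
    converge to [plateau k y], which stays at [2^-k] from some place on, and
    [plateau k y * b] can only be in [L] if [b] is ([subspace_plateau]).  So
    membership in [L] has to survive this limit, and Baire category provides
    that.  The space R^nat * nat^nat, with nat discrete, is a Baire space
    ([comeager_dense]); hence if countably many closed sets cover a comeager
    part of it, one of them contains [(x, y)] for an open set of [x] and a
    family of [y] in which one coordinate runs through all of nat
    ([closed_cover_fiber]).

    If [L] is the union of closed sets [F m], apply this to the sets of [(x, y)]
    with [weight y * b] in [F m]: the limit [plateau k y * b] is then in [F m].

    If [theta] reduces R^nat / L to R^nat / l_infty, then [theta] is continuous
    on a comeager set [C], and the sets to use are those of the [(x, y)] at
    which [theta x] and [theta (x + weight y * b)] differ by at most [m].  The
    variable [x] is there because [plateau k y * b] is in general not
    of the form [weight y * b]: translating by a generic [x] brings the limit point into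
    [C], where [theta] is continuous.  There [theta x] and
    [theta (x + plateau k y * b)] differ by at most [m], so
    [plateau k y * b] is in [L]. *)

(** * Comeager sets and the Baire property *)

Section Comeager.
Context {T : topologicalType}.
Implicit Types A B C U : set T.

Definition comeager A := exists2 G, Gdelta_dense G & G `<=` A.

Lemma comeagerS A B : A `<=` B -> comeager A -> comeager B.
Proof. by move=> AB [G dG GA]; exists G => // x /GA /AB. Qed.

Lemma comeager_open U : open U -> dense U -> comeager U.
Proof.
by move=> oU dU; exists U => //; exists (fun=> U) => //; rewrite bigcap_const.
Qed.

(** Countable index types rather than [nat] let the index carry a coordinate and
    a rational at once. *)
Lemma comeager_forall (I : countType) (P : I -> set T) :
  (forall i, comeager (P i)) -> comeager [set x | forall i, P i x].
Proof.
move=> cP; have denseT : dense [set: T] by move=> O [x Ox] _; exists x.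
have {cP}H i : exists F : (set T)^nat,
    (forall n, open (F n) /\ dense (F n)) /\ \bigcap_n F n `<=` P i.
  by have [G [F oF GE] GP] := cP i; exists F; rewrite -GE.
have {H}[F FP] := choice H.
pose D n := if unpickle n is Some p then F p.1 p.2 else [set: T].
exists (\bigcap_n D n).
  exists D => // n; rewrite /D; case: unpickle => [[i m]|]; last first.
    by split=> //; exact: openT.
  exact: (FP i).1.
move=> x Dx i; apply: (FP i).2 => m _.
by have := Dx (pickle (i, m)) Logic.I; rewrite /D pickleK.
Qed.

Lemma comeagerI A B : comeager A -> comeager B -> comeager (A `&` B).
Proof.
move=> cA cB; have /comeager_forall : forall b : bool, comeager (if b then A else B).
  by case.
by apply: comeagerS => x H; split; [exact: (H true)|exact: (H false)].
Qed.

Definition baire_property A :=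
  exists2 U, open U & comeager [set x | A x <-> U x].

Lemma open_baire_property U : open U -> baire_property U.
Proof.
move=> oU; exists U => //.
apply: (comeagerS (A := setT)) => //; apply: comeager_open; first exact: openT.
by move=> O [x Ox] _; exists x.
Qed.

(** [~` A] agrees with [~` U] off a meager set, and [~` U] agrees with its
    interior off the boundary of [U], which is closed with empty interior. *)
Lemma baire_propertyC A : baire_property A -> baire_property (~` A).
Proof.
move=> [U oU cU]; exists (~` U)°; first exact: open_interior.
have cU' : comeager (U `|` (~` U)°).
  apply: comeager_open; first by apply: openU => //; exact: open_interior.
  move=> O [x Ox] oO; have [[y [Oy Uy]]|OU] := pselect (O `&` U !=set0).
    by exists y; split=> //; left.
  exists x; split=> //; right; apply: filterS (open_nbhs_nbhs (conj oO Ox)).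
  by move=> y Oy Uy; apply: OU; exists y.
apply: comeagerS (comeagerI cU cU') => x /= [AU UU]; split=> [nA|].
  by case: UU => // /AU.
by move=> /interior_subset nU /AU.
Qed.

Lemma baire_property_bigcup (A : (set T)^nat) :
  (forall n, baire_property (A n)) -> baire_property (\bigcup_n A n).
Proof.
move=> bA; have H n : exists U, open U /\ comeager [set x | A n x <-> U x].
  by have [U ? ?] := bA n; exists U.
have [U AU] := choice H.
exists (\bigcup_n U n); first by apply: bigcup_open => n _; exact: (AU n).1.
have := comeager_forall (fun n => (AU n).2).
by apply: comeagerS => x /= E; split=> -[n _ /E ?]; exists n.
Qed.

Lemma borel_baire_property A : borel_set A -> baire_property A.
Proof.
apply; split; last exact: open_baire_property.
split; first exact/open_baire_property/open0.
  by move=> B bB; rewrite setTD; exact: baire_propertyC.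
exact: baire_property_bigcup.
Qed.

End Comeager.

Lemma comeager_preimage (S T : topologicalType) (f : S -> T) (A : set T) :
  continuous f -> (forall D, open D -> dense D -> dense (f @^-1` D)) ->
  comeager A -> comeager (f @^-1` A).
Proof.
move=> cf df [_ [F oF ->] FA]; have cF n : comeager (f @^-1` F n).
  have [oFn dFn] := oF n.
  by apply: comeager_open; [exact: (continuousP _).1|exact: df].
by apply: comeagerS (comeager_forall cF) => x Fx; apply: FA => n _; exact: Fx.
Qed.

Lemma coord_continuous (R : realType) (i : nat) :
  continuous (fun x : {ptws nat -> R} => x i).
Proof. exact: (@proj_continuous nat (fun=> R) i). Qed.

(** The preimages of the countably many rays with rational endpoints have the
    Baire property; where all of them coincide with their open models, a
    sequence-valued function is continuous relative to that set. *)
Lemma borel_function_continuous_on_comeager (R : realType) (T : topologicalType)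
    (theta : T -> {ptws nat -> R}) :
  borel_function theta ->
  exists2 C, comeager C &
    forall i x, C x -> (fun y => theta y i) @ within C (nbhs x) --> theta x i.
Proof.
move=> btheta.
(* [(i, q, b)] stands for the ray below [q] or above [q] in coordinate [i]. *)
pose ray (p : nat * rat * bool) : set {ptws nat -> R} :=
  [set a | if p.2 then a p.1.1 < ratr p.1.2 else ratr p.1.2 < a p.1.1].
have bray p : baire_property (theta @^-1` ray p).
  apply: borel_baire_property; apply: btheta; apply: sub_sigma_algebra.
  case: p => [[i q] []].
    exact: (continuousP _).1 (@coord_continuous R i) _ (@open_lt R (ratr q)).
  exact: (continuousP _).1 (@coord_continuous R i) _ (@open_gt R (ratr q)).
have H p : exists U, open U /\ comeager [set x | ray p (theta x) <-> U x].
  by have [U ? ?] := bray p; exists U.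
have [U rayU] := choice H.
exists [set x | forall p, ray p (theta x) <-> U p x].
  exact: comeager_forall (fun p => (rayU p).2).
move=> i x Cx; set C := [set x | _] in Cx *.
have near_ray p : ray p (theta x) ->
    \forall y \near within C (nbhs x), ray p (theta y).
  move=> /Cx Upx; rewrite /= nearE /within.
  apply: filterS (open_nbhs_nbhs (conj (rayU p).1 Upx)) => y Upy Cy.
  by apply/(Cy p).
apply/cvgrPdist_lt => e e0.
(* Two rational rays confine the coordinate to an interval of radius [e]. *)
have [q1 q1P] : exists q, ratr q \in `]theta x i - e, theta x i[.
  by apply: rat_in_itvoo; rewrite ltrBlDr ltrDl.
have [q2 q2P] : exists q, ratr q \in `]theta x i, theta x i + e[.
  by apply: rat_in_itvoo; rewrite ltrDl.
move: q1P q2P; rewrite !in_itv /= => /andP[q1l q1r] /andP[q2l q2r].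
have n1 := near_ray (i, q1, false) q1r.
have n2 := near_ray (i, q2, true) q2l.
apply: filterS2 n1 n2 => y /= y1 y2.
by rewrite distrC ltr_distl (lt_trans q1l y1) (lt_trans y2 q2r).
Qed.

(** * A Baire space: R^nat * nat^nat *)

Lemma filter_forall_ltn (T : Type) (F : set_system T) (FF : Filter F)
    (n : nat) (P : nat -> set T) :
  (forall i, F (P i)) -> F [set x | forall i, (i < n)%N -> P i x].
Proof.
move=> FP; have := @filter_forall _ 'I_n _ _ FF (fun i => FP i).
by apply: filterS => x Px i lt_in; exact: (Px (Ordinal lt_in)).
Qed.

Section Cells.
Context {R : realType}.
Local Notation Z := ({ptws nat -> R} * {ptws nat -> nat})%type.

(** A basic neighbourhood with a single parameter: [n] bounds both the number of
    coordinates concerned and the inverse of the radius.  The inequality is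
    large so that nested cells keep the limit of their centres. *)
Definition cell (n : nat) (z : Z) : set Z :=
  [set w | forall i, (i < n)%N ->
    `|z.1 i - w.1 i| <= n.+1%:R^-1 /\ w.2 i = z.2 i].

Lemma cell_refl n z : cell n z z.
Proof. by move=> i _; rewrite subrr normr0 invr_ge0. Qed.

Lemma cell_le m n z : (m <= n)%N -> cell n z `<=` cell m z.
Proof.
move=> mn w zw i im; have [zwi ->] := zw i (leq_trans im mn); split=> //.
by apply: le_trans zwi _; rewrite lef_pV2 ?posrE// ler_nat.
Qed.

Lemma nbhs_cell n (z : Z) : nbhs z (cell n z).
Proof.
have n0 : 0 < n.+1%:R^-1 :> R by rewrite invr_gt0.
pose A1 : set {ptws nat -> R} :=
  [set x | forall i, (i < n)%N -> `|z.1 i - x i| <= n.+1%:R^-1].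
pose A2 : set {ptws nat -> nat} :=
  [set y | forall i, (i < n)%N -> y i = z.2 i].
have zA1 : nbhs z.1 A1.
  apply: (@filter_forall_ltn _ (nbhs z.1) _ n
    (fun i (x : {ptws nat -> R}) => `|z.1 i - x i| <= n.+1%:R^-1)) => i.
  exact: (cvgrPdist_le _ _).1 (@coord_continuous R i z.1) _ n0.
have zA2 : nbhs z.2 A2.
  apply: (@filter_forall_ltn _ (nbhs z.2) _ n
    (fun i (y : {ptws nat -> nat}) => y i = z.2 i)) => i.
  exact: (discrete_cvg _ _ _).1 (@proj_continuous nat (fun=> nat) i z.2).
exists (A1, A2) => // w [/= w1 w2] i lt_in.
by split; [exact: w1|exact: w2].
Qed.

(** The cells around [z] generate a filter that converges coordinatewise, hence
    converges to [z]. *)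
Lemma nbhs_cellP (z : Z) (A : set Z) : nbhs z A <-> exists n, cell n z `<=` A.
Proof.
split; last by move=> [n zA]; apply: filterS zA _; exact: nbhs_cell.
pose F := filter_from setT (fun n => cell n z).
have FF : Filter F.
  apply: filter_from_filter; first by exists 0%N.
  move=> m n _ _; exists (maxn m n) => // w zw.
  by split; apply: cell_le zw; [exact: leq_maxl|exact: leq_maxr].
suff : F --> z by move=> Fz /Fz [n _ zA]; exists n.
have c1 : fst @ F --> z.1.
  apply/pointwise_cvgP => i; apply/cvgrPdist_le => e e0.
  have [n n_e] : exists n, n.+1%:R^-1 <= e.
    by have [n] := ltr_add_invr e0; rewrite add0r => /ltW; exists n.
  exists (maxn n i.+1) => // w zw.
  have [zwi _] := zw i (leq_maxr _ _).
  apply: le_trans n_e. apply: le_trans zwi _.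
  by rewrite lef_pV2 ?posrE// ler_nat ltnS leq_maxl.
have c2 : snd @ F --> z.2.
  apply/pointwise_cvgP => i; apply/discrete_cvg.
  by exists i.+1 => // w zw; exact: (zw i (ltnSn i)).2.
move=> B [[B1 B2] [/= /c1 FB1 /c2 FB2] sub].
apply: (@filterS2 _ F FF (fst @^-1` B1) (snd @^-1` B2) B _ FB1 FB2) => w w1 w2.
exact: (sub w).
Qed.

(** As [n <= k n], the centres are Cauchy in every real coordinate and eventually
    constant in every discrete one. *)
Lemma cell_nested_nonempty (k : nat -> nat) (z : nat -> Z) :
  (forall n, (n <= k n)%N) ->
  (forall n, cell (k n.+1) (z n.+1) `<=` cell (k n) (z n)) ->
  \bigcap_n cell (k n) (z n) !=set0.
Proof.
move=> nk nested.
have sub m n : (n <= m)%N -> cell (k m) (z m) `<=` cell (k n) (z n).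
  elim: m => [|m IH]; first by rewrite leqn0 => /eqP ->.
  rewrite leq_eqVlt => /predU1P[-> //|/ltnSE /IH mn].
  exact: subset_trans (nested m) mn.
have dist i m n : (i < k n)%N -> (n <= m)%N ->
    `|(z n).1 i - (z m).1 i| <= (k n).+1%:R^-1 /\ (z m).2 i = (z n).2 i.
  by move=> ik nm; exact: (sub _ _ nm _ (@cell_refl (k m) (z m)) _ ik).
have cvg1 i : cvgn (fun n => (z n).1 i).
  apply: cauchy_cvg; apply/cauchy_exP => e e0.
  have [N eN] := ltr_add_invr e0; rewrite add0r in eN.
  pose n := maxn N i.+1.
  exists ((z n).1 i); exists n => // m nm; rewrite /= -ball_normE /=.
  have ikn : (i < k n)%N by apply: leq_trans (nk n); exact: leq_maxr.
  apply: le_lt_trans eN; apply: le_trans (dist _ _ _ ikn nm).1 _.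
  by rewrite lef_pV2 ?posrE// ler_nat ltnS (leq_trans _ (nk n)) ?leq_maxl.
exists ((fun i => limn (fun n => (z n).1 i)), (fun i => (z i.+1).2 i)) => n _ i ik /=.
split.
  have : `|(z n).1 i - (z m).1 i| @[m --> \oo] -->
      `|(z n).1 i - limn (fun m => (z m).1 i)|.
    exact: cvg_norm (cvgB (cvg_cst _) (cvg1 i)).
  move=> /cvgr_to_le; apply.
  by exists n => // m nm; exact: (dist _ _ _ ik nm).1.
have [ni|lt_in] := leqP n i.+1; first by rewrite (dist _ _ _ ik ni).2.
by rewrite (dist i _ _ _ (ltnW lt_in)).2 // (leq_trans _ (nk _)).
Qed.

(** The Baire category theorem: a nested sequence of cells, the [n]-th one inside
    the [n]-th dense open set, has a common point. *)
Lemma comeager_dense (A : set Z) : comeager A -> dense A.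
Proof.
move=> [_ [F oF ->] FA] W [z0 Wz0] oW.
have shrink (n : nat) (B : set Z) (z : Z) : nbhs z B ->
    exists p : nat * Z, (n < p.1)%N /\ cell p.1 p.2 `<=` B `&` F n.
  move=> /nbhs_interior Bz.
  have [w [Bw Fw]] := (oF n).2 _ (ex_intro _ z (nbhs_singleton Bz)) (open_interior B).
  have : nbhs w (B `&` F n).
    by apply: filterI => //; exact: open_nbhs_nbhs (conj (oF n).1 Fw).
  move=> /nbhs_cellP [m mB]; exists (maxn m n.+1, w); split; first exact: leq_maxr.
  by apply: subset_trans mB; apply: cell_le; exact: leq_maxl.
have [p0 [_ p0W]] := shrink 0%N W z0 (open_nbhs_nbhs (conj oW Wz0)).
have step (q : nat * (nat * Z)) : exists p : nat * Z,
    (q.1.+1 < p.1)%N /\ cell p.1 p.2 `<=` cell q.2.1 q.2.2 `&` F q.1.+1.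
  exact: shrink (nbhs_cell _ _).
have [next nextP] := choice step.
pose p := fix p n := if n is m.+1 then next (m, p m) else p0.
have [|n|z zP] := @cell_nested_nonempty (fun n => (p n).1) (fun n => (p n).2).
- case=> [//|n]; exact: ltnW (nextP (n, p n)).1.
- by move=> z /(nextP (n, p n)).2 [].
exists z; split; first exact: (p0W _ (zP 0%N Logic.I)).1.
apply: FA => -[|n] _; first exact: (p0W _ (zP 0%N Logic.I)).2.
exact: ((nextP (n, p n)).2 _ (zP n.+1 Logic.I)).2.
Qed.
End Cells.

(** * Weights halved at prescribed places *)

Section Weights.
Implicit Types (y : nat -> nat) (i j k n : nat).

(** The strictly increasing sequence of places with gaps given by [y]. *)
Definition drop_pos y j : nat := (\sum_(0 <= l < j.+1) (y l).+1)%N.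

Definition drops k y i : nat := (\sum_(0 <= j < k) (drop_pos y j <= i))%N.

Definition set_coord y k n : nat -> nat := fun l => if l == k then n else y l.

Lemma drop_pos_gt y j : (j < drop_pos y j)%N.
Proof.
rewrite /drop_pos; elim: j => [|j IH]; first by rewrite big_nat1.
by rewrite big_nat_recr //= addnS ltnS (leq_trans IH) // leq_addr.
Qed.

Lemma drop_pos_le y j j' : (j <= j')%N -> (drop_pos y j <= drop_pos y j')%N.
Proof.
by move=> jj'; rewrite /drop_pos [leqRHS](@big_cat_nat _ _ _ j.+1) //= leq_addr.
Qed.

(** The [j]-th place lies beyond [j], so only the first [i] places can be passed. *)
Lemma drops_stable k y i : (i <= k)%N -> drops k y i = drops i y i.
Proof.
move=> ik; rewrite {1}/drops (@big_cat_nat _ _ _ i) //= [X in (_ + X)%N]big_nat_cond.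
rewrite [X in (_ + X)%N]big1 ?addn0 // => j /andP[/andP[ij _] _].
by rewrite leqNgt (leq_ltn_trans ij) ?drop_pos_gt.
Qed.

Lemma drops_le k y i i' : (i <= i')%N -> (drops k y i <= drops k y i')%N.
Proof.
move=> ii'; rewrite /drops; apply: leq_sum => j _.
by case: (leqP _ i) => // /leq_trans -> .
Qed.

Lemma drops_all k y i : (drop_pos y k <= i)%N -> drops k y i = k.
Proof.
move=> ki; rewrite /drops big_nat_cond (eq_bigr (fun=> 1%N)).
  by rewrite -big_nat_cond sum_nat_const_nat muln1 subn0.
move=> j /andP[/andP[_ jk] _].
by rewrite (leq_trans (drop_pos_le y (ltnW jk)) ki).
Qed.

(** Setting the coordinate [k] to [n] leaves the first [k] places alone and pushes
    the others beyond [n]. *)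
Lemma drops_set_coord y k n i : (i <= n)%N ->
  drops i (set_coord y k n) i = drops k y i.
Proof.
move=> i_n.
have before j : (j < k)%N -> drop_pos (set_coord y k n) j = drop_pos y j.
  move=> jk; rewrite /drop_pos; apply: eq_big_nat => l /andP[_ lj].
  by rewrite /set_coord ltn_eqF // (leq_ltn_trans _ jk).
have after j : (k <= j)%N -> (n < drop_pos (set_coord y k n) j)%N.
  move=> kj; apply: leq_trans (drop_pos_le _ kj).
  by rewrite /drop_pos big_nat_recr //= /set_coord eqxx addnS ltnS leq_addl.
rewrite -(@drops_stable (maxn i k)) ?leq_maxl // {1}/drops.
rewrite (@big_cat_nat _ _ _ k) ?leq_maxr //= [X in (_ + X)%N]big_nat_cond.
rewrite [X in (_ + X)%N]big1 ?addn0; last first.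
  move=> j /andP[/andP[kj _] _].
  by rewrite leqNgt (leq_ltn_trans i_n) ?after.
by apply: eq_big_nat => j /andP[_ jk]; rewrite before.
Qed.

End Weights.

(** * Abel summation *)

Section Abel.
Context {R : realType}.

(** Summation by parts leaves [t n *: S n], which tends to 0, and a series of terms
    [(t n - t n.+1) *: S n.+1], absolutely convergent because its norms are
    dominated by [M] times a telescoping series. *)
Lemma abel_cvg (X : completeNormedModType R) (x : nat -> X) (t : nat -> R) (M : R) :
  (forall n, `|\sum_(0 <= i < n) x i| <= M) ->
  {homo t : m n / (m <= n)%N >-> n <= m} -> t @ \oo --> (0 : R) ->
  cvgn (series (fun n => t n *: x n)).
Proof.
move=> SM tdec t0; pose S n := \sum_(0 <= i < n) x i.
have t_ge0 n : 0 <= t n.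
  by apply: (cvgr_to_le t0); exists n => // m /=; exact: tdec.
have tD n : 0 <= t n - t n.+1 by rewrite subr_ge0 tdec.
have M0 : 0 <= M by apply: le_trans (SM 0%N).
have parts n : series (fun n => t n *: x n) n =
    t n *: S n + series (fun n => (t n - t n.+1) *: S n.+1) n.
  rewrite /series /=; elim: n => [|n IH].
    by rewrite !big_geq // /S big_geq // scaler0 addr0.
  rewrite big_nat_recr //= IH [in RHS]big_nat_recr //= scalerBl.
  rewrite [RHS]addrC -[RHS]addrA subrK [X in _ = _ + t n *: X](_ : _ = S n + x n).
    by rewrite scalerDr addrA [X in X + _ = _]addrC.
  by rewrite /S big_nat_recr.
rewrite (funext parts); apply: is_cvgD.
  apply: (cvgP (0 : X)); apply: norm_cvg0.
  apply: (squeeze_cvgr (f := fun=> 0) (h := fun n => t n * M)).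
  - apply: nearW => n; rewrite normr_ge0 /= normrZ (ger0_norm (t_ge0 n)).
    exact: ler_wpM2l (t_ge0 n) _ _ (SM n).
  - exact: cvg_cst.
  - by rewrite -(mul0r M); apply: cvgMr_tmp.
apply: normed_cvg.
apply: (@series_le_cvg R _ (M *: (fun n => t n - t n.+1))).
- by move=> n; exact: normr_ge0.
- by move=> n; apply: mulr_ge0.
- move=> n; rewrite /= normrZ (ger0_norm (tD n)) mulrC.
  exact: ler_wpM2r (tD n) _ _ (SM n.+1).
apply: is_cvg_seriesZ.
have -> : series (fun n => t n - t n.+1) = fun n => t 0%N - t n.
  apply/funext => n; rewrite /series /=; elim: n => [|n IH].
    by rewrite big_geq // subrr.
  by rewrite big_nat_recr //= IH addrA subrK.
by apply: is_cvgB; [exact: is_cvg_cst|exact: (cvgP _ t0)].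
Qed.

End Abel.

(** * The category argument *)

Section Weighted.
Context {R : realType}.
Local Notation RN := {ptws nat -> R}.
Local Notation NN := {ptws nat -> nat}.
Local Notation Z := (RN * NN)%type.

(** Only the first [k] drops are performed, so the values settle at [2^-k]. *)
Definition plateau (k : nat) (y : nat -> nat) (i : nat) : R := 2^-1 ^+ drops k y i.

(** All drops are performed; since no place beyond the [i]-th is passed at [i],
    counting the first [i] of them suffices, and the value at [i] depends on
    finitely many coordinates of [y] only. *)
Definition weight (y : nat -> nat) (i : nat) : R := plateau i y i.

Lemma plateau_le k y : {homo plateau k y : m n / (m <= n)%N >-> n <= m}.
Proof.
move=> m n mn; rewrite /plateau ler_wiXn2l ?invr_ge0 ?invf_le1 ?ler1n //.
exact: drops_le.
Qed.

Lemma plateau_eventually k y i : (drop_pos y k <= i)%N -> plateau k y i = 2^-1 ^+ k.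
Proof. by move=> ki; rewrite /plateau drops_all. Qed.

Lemma weight_plateau k y i : (i <= k)%N -> weight y i = plateau k y i.
Proof. by move=> ik; rewrite /weight /plateau (drops_stable y ik). Qed.

Lemma weight_le y : {homo weight y : m n / (m <= n)%N >-> n <= m}.
Proof.
by move=> m n mn; rewrite (weight_plateau y mn); exact: plateau_le.
Qed.

Lemma weight_cvg0 y : weight y @ \oo --> (0 : R).
Proof.
have half0 : (fun n => 2^-1 ^+ n : R) @ \oo --> (0 : R).
  by apply: cvg_expr; rewrite ger0_norm ?invf_lt1 ?ltr1n ?invr_ge0.
apply/cvgrPdist_le => e e0.
have [K _ Ke] := (cvgrPdist_le _ _).1 half0 _ e0.
exists (drop_pos y K) => // i /= Ki.
have := Ke K (leqnn K); rewrite /= !sub0r !normrN; apply: le_trans.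
rewrite !ger0_norm ?exprn_ge0 ?invr_ge0 // -(plateau_eventually Ki).
have K_i : (K <= i)%N := leq_trans (ltnW (drop_pos_gt y K)) Ki.
rewrite /weight /plateau ler_wiXn2l ?invr_ge0 ?invf_le1 ?ler1n //.
by rewrite /drops [leqRHS](@big_cat_nat _ _ _ K) //= leq_addr.
Qed.

Lemma weight_set_coord k y n i : (i <= n)%N ->
  weight (set_coord y k n) i = plateau k y i.
Proof. by move=> i_n; rewrite /weight /plateau drops_set_coord. Qed.

Definition weighted (b : nat -> R) (y : NN) : RN := fun i => weight y i * b i.

Lemma ptws_continuous (S : topologicalType) (f : S -> RN) :
  (forall i, continuous (fun s => f s i)) -> continuous f.
Proof. by move=> cf s; apply/pointwise_cvgP => i; exact: cf. Qed.

Lemma weighted_continuous b : continuous (weighted b).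
Proof.
apply: ptws_continuous => i y; apply: cvg_near_cst.
have : nbhs y [set y' : NN | forall l, (l < i)%N -> y' l = y l].
  apply: (@filter_forall_ltn _ (nbhs y) _ i (fun l (y' : NN) => y' l = y l)) => l.
  exact: (discrete_cvg _ _ _).1 (@proj_continuous nat (fun=> nat) l y).
apply: filterS => y' yy'; congr (2^-1 ^+ _ * _).
apply: eq_big_nat => j /andP[_ ji]; congr (_ <= _)%N.
apply: eq_big_nat => l /andP[_ lj]; rewrite yy' //.
exact: leq_trans lj ji.
Qed.

(** The limit leaves the family: it is not [weighted b y'] for any [y'], because
    its weights do not tend to 0 (unless [b] vanishes from some point on). *)
Lemma weighted_cvg b k y :
  (fun n => weighted b (set_coord y k n)) @ \oo -->
    ((fun i => plateau k y i * b i) : RN).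
Proof.
apply/pointwise_cvgP => i; apply: cvg_near_cst.
by exists i => // n /= i_n; rewrite /weighted weight_set_coord.
Qed.

Definition translate (f : NN -> RN) (z : Z) : RN := fun i => z.1 i + f z.2 i.

Lemma translate_continuous f : continuous f -> continuous (translate f).
Proof.
move=> cf; apply: ptws_continuous => i z.
have c1 : (fun w : Z => w.1 i) @ z --> z.1 i.
  exact: (cvg_comp _ _ (@cvg_fst _ _ (nbhs z.1) (nbhs z.2) _)
    (@coord_continuous R i z.1)).
have c2 : (fun w : Z => f w.2 i) @ z --> f z.2 i.
  have c := cvg_comp _ _ (cf z.2) (@coord_continuous R i (f z.2)).
  exact: (cvg_comp _ _ (@cvg_snd _ _ (nbhs z.1) (nbhs z.2) _) c).
exact: (@cvgD _ _ _ _ (nbhs_filter z) _ _ _ _ c1 c2).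
Qed.

(** For each fixed [y] the map [x |-> x + f y] is a homeomorphism, so a dense open
    set is met already on a single horizontal fibre. *)
Lemma comeager_translate f (A : set RN) :
  continuous f -> comeager A -> comeager (translate f @^-1` A).
Proof.
move=> cf; apply: comeager_preimage; first exact: translate_continuous.
move=> D oD dD W [[x y] Wxy] oW.
pose g (w : RN) : Z := ((fun i => w i - f y i), y).
have cg : continuous g.
  have cg1 : continuous (fun w : RN => (fun i => w i - f y i) : RN).
    apply: ptws_continuous => i v.
    exact: cvgB (@coord_continuous R i v) (cvg_cst _).
  by move=> w; apply: (cvg_pair (cg1 w) (cvg_cst y)).
have gW0 : (g @^-1` W) !=set0.
  exists (translate f (x, y)); rewrite /g /translate /=.
  by rewrite (_ : (fun i => _) = x) //; apply/funext => i; rewrite addrK.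
have [w [Ww Dw]] := dD _ gW0 ((continuousP _).1 cg _ oW).
exists (g w); split => //; rewrite /preimage /= /translate /g /=.
by rewrite (_ : (fun i => _) = w) //; apply/funext => i; rewrite subrK.
Qed.

(** By the Baire category theorem some [F m] contains a cell; a cell restricts
    only the first [k] coordinates of [y], so the coordinate [k] is free. *)
Lemma closed_cover_fiber (F : nat -> set Z) (A : set Z) :
  (forall m, closed (F m)) -> comeager A -> A `<=` \bigcup_m F m ->
  exists m (O : set RN) (y : NN) k, [/\ open O, O !=set0 &
    forall x n, O x -> F m (x, set_coord y k n)].
Proof.
move=> clF cA AF.
have [m ndF] : exists m, ~ dense (~` F m).
  apply/existsNP => dF.
  have /comeager_forall cF m : comeager (~` F m).
    by apply: comeager_open => //; rewrite openC.
  have [z [_ [Az nFz]]] := comeager_dense (comeagerI cA cF)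
    (ex_intro _ ((fun=> 0), (fun=> 0%N)) Logic.I) openT.
  by have [m _ Fz] := AF z Az; exact: nFz Fz.
have [W [[z [oW Wz]] WF]] := denseNE ndF.
have [k kW] := (nbhs_cellP _ _).1 (open_nbhs_nbhs (conj oW Wz)).
pose h (x : RN) : Z := (x, z.2).
have ch : h @ z.1 --> z.
  case: z {oW Wz kW} @h => z1 z2 h.
  exact: (cvg_pair (@cvg_id _ (nbhs z1)) (cvg_cst z2)).
exists m, (h @^-1` cell k z)°, z.2, k; split; first exact: open_interior.
  exists z.1; apply: ch; exact: nbhs_cell.
move=> x n /interior_subset zx; apply: contrapT => nF.
suff : (W `&` ~` F m) (x, set_coord z.2 k n) by rewrite WF.
split=> //; apply: kW => i ik; have [zxi _] := zx i ik; split=> //=.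
by rewrite /set_coord ltn_eqF.
Qed.

End Weighted.

(** * Bounded completeness, F_sigma and reducibility *)

Section Banach.
Context {R : realType} (L : set {ptws nat -> R})
    (X : completeNormedModType R) (j : {linear X -> (nat -> R)})
    (jL : range j = L)
    (e : nat -> X) (e_basis : unit_vector_basis j e).
Local Notation RN := {ptws nat -> R}.
Local Notation NN := {ptws nat -> nat}.
Local Notation Z := (RN * NN)%type.

Definition partial_sum (n : nat) (a : nat -> R) : X :=
  series (fun i => a i *: e i) n.

Definition bounded_sums (a : nat -> R) :=
  exists M : R, forall n, `|partial_sum n a| <= M.

Lemma partial_sumS n a : partial_sum n.+1 a = partial_sum n a + a n *: e n.
Proof. by rewrite /partial_sum /series /= big_nat_recr. Qed.

Lemma partial_sumB n a b :
  partial_sum n (fun i => a i - b i) = partial_sum n a - partial_sum n b.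
Proof.
rewrite /partial_sum /series /= -sumrB; apply: eq_bigr => i _.
by rewrite scalerBl.
Qed.

Lemma partial_sum_continuous n : continuous (partial_sum n : RN -> X).
Proof.
elim: n => [|n IH].
  have -> : (partial_sum 0 : RN -> X) = fun=> 0.
    by apply/funext => a; rewrite /partial_sum /series /= big_geq.
  exact: (@cst_continuous RN X 0).
have -> : (partial_sum n.+1 : RN -> X) = fun a => partial_sum n a + a n *: e n.
  by apply/funext => a; exact: partial_sumS.
by move=> a; exact: cvgD (IH a) (cvgZr_tmp (@coord_continuous R n a)).
Qed.

Lemma subspace_series a : L a <-> cvgn (series (fun i => a i *: e i)).
Proof.
have [_ basis coords] := e_basis; rewrite -jL; split.
  move=> [v _ <-]; have [c [cv _]] := basis v.
  by rewrite -(coords v c cv); exact: cvgP cv.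
by move=> /(coords _ a) ->; exists (limn (series (fun i => a i *: e i))).
Qed.

Lemma subspaceB a b : L a -> L b -> L (fun i => a i - b i).
Proof.
rewrite -jL => -[u _ <-] [v _ <-]; exists (u - v) => //.
by rewrite linearB.
Qed.

Lemma subspaceZ c a : L a -> L (fun i => c * a i).
Proof.
by rewrite -jL => -[u _ <-]; exists (c *: u) => //; rewrite linearZ.
Qed.

Lemma subspace_bounded_sums a : L a -> bounded_sums a.
Proof.
move=> /subspace_series /cvg_seq_bounded [M [Mr HM]].
exists (M + 1) => n; apply: HM => //; by rewrite ltrDl.
Qed.

Lemma subspace_decreasing_multiple (b t : nat -> R) : bounded_sums b ->
  {homo t : m n / (m <= n)%N >-> n <= m} -> t @ \oo --> (0 : R) ->
  L (fun i => t i * b i).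
Proof.
move=> [M bM] tdec t0; apply/subspace_series.
have := @abel_cvg R X (fun i => b i *: e i) t M bM tdec t0.
by under eq_fun do rewrite scalerA.
Qed.

(** [plateau k y] minus its final value [2^-k] decreases to 0, so that multiple of
    [b] is in [L]; subtracting leaves [2^-k] times [b]. *)
Lemma subspace_plateau b k y : bounded_sums b ->
  L (fun i => plateau k y i * b i) -> L b.
Proof.
move=> bb Lp; pose c : R := 2^-1 ^+ k.
have c0 : c != 0 by rewrite expf_neq0 ?invr_eq0.
have Lt : L (fun i => (plateau k y i - c) * b i).
  apply: subspace_decreasing_multiple => //.
    by move=> m n mn; rewrite lerB ?plateau_le.
  apply: cvg_near_cst; exists (drop_pos y k) => // i ki.
  by rewrite (plateau_eventually ki) subrr.
have := subspaceZ c^-1 (subspaceB Lp Lt).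
rewrite (_ : (fun i => _) = b) //; apply/funext => i.
by rewrite mulrBl opprB addrCA subrr addr0 mulrA mulVf // mul1r.
Qed.

(** Membership in [L] is convergence of the expansion, so the definition of bounded
    completeness can be phrased without series. *)
Lemma boundedly_completeP :
  boundedly_complete_basis e <-> forall b, bounded_sums b -> L b.
Proof.
have [_ basis _] := e_basis; split=> [[_ bc] b [M bM]|bL].
  apply/subspace_series; apply: bc; exists M => n.
  by have := bM n.+1; rewrite /partial_sum /series /= big_mkord.
split=> // b [M bM]; apply/subspace_series; apply: bL; exists M => -[|n].
  rewrite /partial_sum /series /= big_geq // normr0.
  by apply: le_trans (bM 0%N).
by rewrite /partial_sum /series /= big_mkord.
Qed.

Lemma weighted_subspace b y : bounded_sums b -> L (weighted b y).
Proof.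
move=> bb; exact: subspace_decreasing_multiple bb (@weight_le R y) (@weight_cvg0 R y).
Qed.

Lemma boundedly_complete_Fsigma : boundedly_complete_basis e -> Fsigma L.
Proof.
move=> /boundedly_completeP bL.
exists (fun m => \bigcap_n [set a | `|partial_sum n a| <= m%:R]).
  move=> m; apply: closed_bigI => n _.
  have cn : continuous (fun a : RN => `|partial_sum n a|).
    by move=> a; exact: (cvg_norm (@partial_sum_continuous n a)).
  exact: (preimage_closed (fun a _ => cn a) (@closed_le R m%:R)).
apply/seteqP; split=> a; last first.
  by move=> [m _ am]; apply: bL; exists m%:R => n; exact: am.
move=> /subspace_bounded_sums [M aM].
exists (Num.bound M) => // n _ /=; apply: le_trans (aM n) _.
by apply: ltW; exact: unstable.ltr_bound.
Qed.

Lemma Fsigma_boundedly_complete : Fsigma L -> boundedly_complete_basis e.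
Proof.
move=> [F clF LF]; apply/boundedly_completeP => b bb.
have clF' m : closed ((fun z : Z => weighted b z.2) @^-1` F m).
  apply: (preimage_closed _ (clF m)) => z _.
  exact: (cvg_comp _ _ (@cvg_snd _ _ (nbhs z.1) (nbhs z.2) _)
    (@weighted_continuous R b z.2)).
have cT : comeager [set: Z].
  by apply: comeager_open; [exact: openT|move=> O [x Ox] _; exists x].
have cover : [set: Z] `<=` \bigcup_m ((fun z : Z => weighted b z.2) @^-1` F m).
  by move=> z _; have := weighted_subspace z.2 bb; rewrite LF => -[m _ Fm]; exists m.
have [m [V [y [k [oV [x Vx] HF]]]]] := closed_cover_fiber clF' cT cover.
apply: (@subspace_plateau b k y) => //; rewrite LF; exists m => //.
have FW : \forall n \near \oo, F m (weighted b (set_coord y k n)).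
  by apply: nearW => n; exact: (HF x n Vx).
exact: (@closed_cvg _ RN _ _ _ (F m) (clF m) FW _ (@weighted_cvg R b k y)).
Qed.

(** The argument of [Fsigma_boundedly_complete], with the differences of [theta]
    in place of membership in a closed set. *)
Lemma borel_reducible_boundedly_complete :
  borel_reducible (coset_rel L) (coset_rel (@ell_infty R)) ->
  boundedly_complete_basis e.
Proof.
move=> [theta [btheta red]]; apply/boundedly_completeP => b bb.
have [C cC Ctheta] := borel_function_continuous_on_comeager btheta.
pose w : Z -> RN := translate (weighted b).
have cw : continuous w := translate_continuous (@weighted_continuous R b).
pose close_by (m : nat) (z : Z) :=
  forall i, `|theta z.1 i - theta (w z) i| <= m%:R.
pose A (m : nat) : set Z := [set z | [/\ C z.1, C (w z) & close_by m z]].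
(* Closing [A m] adds no point [z] with [z.1] and [w z] in [C], as the bound is
   inherited by limits there. *)
have closureA m z : closure (A m) z -> C z.1 -> C (w z) -> close_by m z.
  move=> Az C1 C2 i; apply/ler_addgt0Pr => d d0.
  have d2 : 0 < d / 2 by rewrite divr_gt0.
  have n1 : nbhs z [set u : Z | C u.1 -> `|theta z.1 i - theta u.1 i| < d / 2].
    exact: (@cvg_fst _ _ (nbhs z.1) (nbhs z.2) _ _
      ((cvgrPdist_lt _ _).1 (Ctheta i _ C1) _ d2)).
  have n2 : nbhs z [set u : Z | C (w u) -> `|theta (w z) i - theta (w u) i| < d / 2].
    exact: (cw z _ ((cvgrPdist_lt _ _).1 (Ctheta i _ C2) _ d2)).
  have [u [[Cu1 Cu2 Au] [u1 u2]]] := Az _ (filterI n1 n2).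
  have {}u1 := ltW (u1 Cu1); have {}u2 := ltW (u2 Cu2).
  rewrite (_ : theta z.1 i - theta (w z) i = (theta u.1 i - theta (w u) i) +
    ((theta z.1 i - theta u.1 i) - (theta (w z) i - theta (w u) i))); last by ring.
  apply: le_trans (ler_normD _ _) _; apply: lerD; first exact: Au.
  apply: le_trans (ler_normB _ _) _; rewrite [leRHS](splitr d).
  exact: lerD.
have cover : (fst @^-1` C `&` w @^-1` C) `<=` \bigcup_m closure (A m).
  move=> z [C1 C2].
  have : coset_rel L z.1 (w z).
    rewrite /coset_rel /w /translate.
    have := subspaceZ (-1) (weighted_subspace z.2 bb).
    congr (L _); apply/funext => i; by ring.
  move=> /red [M HM]; exists (Num.bound M) => //; apply: subset_closure.
  split=> // i; apply: le_trans (HM i) _.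
  by apply: ltW; exact: unstable.ltr_bound.
have cfst (f : RN) : comeager [set z : Z | C (fun i => z.1 i + f i)].
  exact: comeager_translate (@cst_continuous NN RN f) cC.
have cfst0 : comeager [set z : Z | C z.1].
  have := cfst (fun=> 0); apply: comeagerS => z /=.
  by rewrite (_ : (fun i => _) = z.1) //; apply/funext => i; rewrite addr0.
have cww : comeager (w @^-1` C) := comeager_translate (@weighted_continuous R b) cC.
have [m [V [y [k [oV [x0 Vx0] HF]]]]] :=
  closed_cover_fiber (fun m => @closed_closure _ (A m)) (comeagerI cfst0 cww) cover.
pose pl : RN := fun i => plateau k y i * b i.
(* One generic [x] puts the whole sequence of translates and its limit in [C]. *)
have cn := comeager_forall (fun n => cfst (weighted b (set_coord y k n))).
have [z [Vz [Cz [Czn Czp]]]] := comeager_dense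
  (comeagerI cfst0 (comeagerI cn (cfst pl)))
  (ex_intro _ (x0, y) Vx0 : (fst @^-1` V : set Z) !=set0)
  ((continuousP _).1 (fun z : Z => @cvg_fst _ _ (nbhs z.1) (nbhs z.2) _) _ oV).
pose x := z.1.
have bound n i : `|theta x i - theta (w (x, set_coord y k n)) i| <= m%:R.
  apply: (closureA m (x, set_coord y k n)) => //; first exact: HF.
  exact: Czn n.
have lim_w : (fun n => w (x, set_coord y k n)) @ \oo -->
    ((fun i => x i + pl i) : RN).
  apply/pointwise_cvgP => i.
  apply: cvg_near_cst; exists i => // n /= i_n.
  by rewrite /w /translate /weighted /= weight_set_coord.
have lim_theta i : (fun n => theta (w (x, set_coord y k n)) i) @ \oo -->
    theta (fun i => x i + pl i) i.
  apply/cvgrPdist_lt => d d0.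
  have [N _ HN] := lim_w _ ((cvgrPdist_lt _ _).1 (Ctheta i _ Czp) _ d0).
  by exists N => // n Nn; exact: (HN n Nn (Czn n)).
apply: (@subspace_plateau b k y) => //.
have : coset_rel (@ell_infty R) (theta x) (theta (fun i => x i + pl i)).
  exists m%:R => i.
  have lim_dist : (fun n => `|theta x i - theta (w (x, set_coord y k n)) i|) @ \oo
      --> `|theta x i - theta (fun i => x i + pl i) i|.
    exact: cvg_norm (cvgB (cvg_cst _) (lim_theta i)).
  by apply: (cvgr_to_le lim_dist); apply: nearW => n; exact: bound.
move=> /red; rewrite /coset_rel => /(subspaceZ (-1)).
by congr (L _); apply/funext => i; rewrite /pl; ring.
Qed.

(** Each coefficient is approximated so well that the [n] errors add up to at most
    [n / (n + 1)]. *)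
Lemma partial_sum_rat_approx n (a : nat -> R) :
  exists q : seq rat, `|partial_sum n a - partial_sum n (fun i => ratr q`_i)| <= 1.
Proof.
have approx i : exists r : rat, `|(a i - ratr r) *: e i| <= n.+1%:R^-1.
  pose d := n.+1%:R^-1 / (`|e i| + 1).
  have e1 : 0 < `|e i| + 1 by rewrite ltr_wpDl.
  have d0 : 0 < d by rewrite divr_gt0 ?invr_gt0.
  have [r] : exists r, ratr r \in `]a i - d, a i + d[.
    by apply: rat_in_itvoo; rewrite ltrBlDr -addrA ltrDl addr_gt0.
  rewrite in_itv /= -ltr_distl distrC => ar; exists r; rewrite normrZ.
  apply: (@le_trans _ _ (d * (`|e i| + 1))); last by rewrite divfK ?gt_eqF.
  by rewrite ler_pM // ?ltW // ltrDl.
have [r rP] := choice approx; exists (mkseq r n).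
rewrite -partial_sumB /partial_sum /series /=.
apply: le_trans (ler_norm_sum _ _ _) _.
apply: (@le_trans _ _ (\sum_(0 <= i < n) n.+1%:R^-1)).
  rewrite big_nat [leRHS]big_nat; apply: ler_sum => i /andP[_ i_n].
  by rewrite nth_mkseq //.
rewrite sumr_const_nat subn0 -[_ *+ n]mulr_natr mulrC ler_pdivrMr // mul1r.
by rewrite ler_nat.
Qed.

Lemma continuous_borel_function (S T : topologicalType) (f : S -> T) :
  continuous f -> borel_function f.
Proof.
move=> cf B bB; apply: (bB [set B | borel_set (f @^-1` B)]); split; last first.
  by move=> U oU; apply: sub_sigma_algebra; exact: (continuousP _).1 cf _ oU.
have [h0 hC hU] := smallest_sigma_algebra setT (@open S).
split; first by rewrite /= preimage_set0.
  by move=> A /hC; rewrite /= !setTD preimage_setC.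
by move=> A hA; rewrite /= preimage_bigcup; exact: hU.
Qed.

(** A Frechet embedding of the sequence of partial sums: the indices [p] enumerate
    the pairs of a length and a rational combination of that length. *)
Definition distances (a : RN) : RN := fun p =>
  if unpickle p is Some (n, q) then
    `|partial_sum n a - partial_sum n (fun i => ratr (q : seq rat)`_i)|
  else 0.

Lemma distances_continuous : continuous distances.
Proof.
apply: ptws_continuous => p; rewrite /distances.
case: (unpickle p) => [[n q]|]; last exact: (@cst_continuous RN R 0).
move=> a; exact: (cvg_norm (cvgB (@partial_sum_continuous n a) (cvg_cst _))).
Qed.

(** Distances to a fixed point are 1-Lipschitz, which gives one direction; in the
    other one, the distances to a combination within 1 of [S_n b] detect
    [S_n a - S_n b] up to the error 2. *)
Lemma boundedly_complete_borel_reducible :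
  boundedly_complete_basis e ->
  borel_reducible (coset_rel L) (coset_rel (@ell_infty R)).
Proof.
move=> /boundedly_completeP bL; exists distances.
split; first exact: (continuous_borel_function distances_continuous).
move=> a b; split=> [/subspace_bounded_sums [M abM]|[M abM]].
  exists M => p; rewrite /distances.
  case: (unpickle p) => [[n q]|].
    apply: le_trans (ler_dist_dist _ _) _.
    rewrite [X in `|X|](_ : _ = partial_sum n a - partial_sum n b).
      by rewrite -partial_sumB.
    by rewrite opprB addrA subrK.
  by rewrite subrr normr0; apply: le_trans (abM 0%N).
apply: bL; exists (M + 1 + 1) => n; rewrite partial_sumB.
have [q bq] := partial_sum_rat_approx n b.
pose c := partial_sum n (fun i => ratr q`_i); rewrite -/c in bq.
have := abM (pickle (n, q)); rewrite /distances pickleK -/c => acbc.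
have -> : partial_sum n a - partial_sum n b =
    (partial_sum n a - c) - (partial_sum n b - c) by rewrite opprB addrA subrK.
apply: le_trans (ler_normB _ _) _; apply: lerD => //.
have -> : `|partial_sum n a - c| = (`|partial_sum n a - c| - `|partial_sum n b - c|)
    + `|partial_sum n b - c| by rewrite subrK.
by apply: lerD => //; exact: le_trans (ler_norm _) acbc.
Qed.

End Banach.

(* [L], with its Banach space structure, is [X]; [j] is the inclusion of [L]
   in R^nat and [e] is the sequence of unit vectors, as elements of [L]. *)
Theorem theorem1p1 (R : realType) (L : set {ptws nat -> R})
    (X : completeNormedModType R) (j : {linear X -> (nat -> R)})
    (j_inj : injective j) (jL : range j = L)
    (e : nat -> X) (e_basis : unit_vector_basis j e) :
  [<-> boundedly_complete_basis e;
       Fsigma L;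
       borel_reducible (coset_rel L) (coset_rel (@ell_infty R))].
Proof.
tfae.
- exact: (boundedly_complete_Fsigma jL e_basis).
- move=> /(Fsigma_boundedly_complete jL e_basis).
  exact: (boundedly_complete_borel_reducible jL e_basis).
- exact: (borel_reducible_boundedly_complete jL e_basis).
Qed.
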